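(* For every $u_0\in l^\infty(\mathbb{R})$ with $\inf_{x\in\mathbb{R}}u_0(x)>0$ and for every $\omega\in\Omega_0$, $$\|u(\cdot,t;u_0,\omega)-1\|_\infty\to0\quad\text{as } t\to\infty,$$ where $u(x,t;u_0,\omega)$ is the solution of $\partial_t v(x,t)=v(x+1,t)+v(x-1,t)-2v(x,t)+a(\theta_t\omega)v(x,t)(1-v(x,t))$, $x\in\mathbb{R}$, with $u(x,0;u_0,\omega)=u_0(x)$.
   Context: Setting: $(\Omega,\mathcal{F},\mathbb{P})$ is a probability space, $\{\theta_t\}_{t\in\mathbb{R}}$ is an ergodic metric dynamical system on it (a jointly measurable, measure-preserving, ergodic flow on $\Omega$), $a:\Omega\to(0,\infty)$ is measurable, and $t\mapsto a(\theta_t\omega)$ is locally H\''older continuous on $\mathbb{R}$ for every $\omega\in\Omega$. Define $\underline{a}(\omega)=\lim_{r\to\infty}\inf_{t-s\ge r}\frac{1}{t-s}\int_s^t a(\theta_\tau\omega)\,d\tau$ and $\overline{a}(\omega)=\lim_{r\to\infty}\sup_{t-s\ge r}\frac{1}{t-s}\int_s^t a(\theta_\tau\omega)\,d\tau$. Standing assumption: $0<\underline{a}(\omega)\le\overline{a}(\omega)<\infty$ for a.e. $\omega\in\Omega$. By ergodicity there are constants $\underline{a},\overline{a}>0$ and a measurable set $\Omega_0\subset\Omega$ with $\mathbb{P}(\Omega_0)=1$, $\theta_t\Omega_0=\Omega_0$ for all $t\in\mathbb{R}$, and $\underline{a}(\omega)=\underline{a}$, $\overline{a}(\omega)=\overline{a}$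 for all $\omega\in\Omega_0$; these are fixed. $l^\infty(\mathbb{R})$ is the space of all bounded functions $u:\mathbb{R}\to\mathbb{R}$ with the sup norm $\|\cdot\|_\infty$. Solutions are understood as solutions of the ODE in $l^\infty(\mathbb{R})$; for nonnegative initial data they are unique and exist for all $t\ge0$. *)

(* Defs.v *)
From HB Require Import structures.
From mathcomp Require Import all_boot all_order all_algebra.
From mathcomp Require Import all_classical all_reals all_analysis.

Set Implicit Arguments.
Unset Strict Implicit.
Unset Printing Implicit Defensive.

Import Order.TTheory GRing.Theory Num.Theory.
Import numFieldNormedType.Exports.

Local Open Scope classical_set_scope.
Local Open Scope ring_scope.

(** * The normed space of bounded functions on the real line *)

Section BoundedFunctions.
Context (R : realType).

Definition bounded_pred : {pred R -> R} := mem (bounded_fun : set (R -> R)).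

Lemma bounded_predP (f : R -> R) :
  reflect (exists M, forall x, `|f x| <= M) (f \in bounded_pred).
Proof.
apply: (iffP idP) => [/set_mem /= /pinfty_ex_gt0[M _ fM]|[M fM]].
  by exists M => x; exact: fM.
apply/mem_set => /=; exists M; split; first exact: num_real.
by move=> N /ltW MN x _ /=; exact: le_trans (fM x) MN.
Qed.

Lemma bounded_pred_submod_closed : submod_closed bounded_pred.
Proof.
split; first by apply/bounded_predP; exists 0 => x; rewrite normr0.
move=> a f g /bounded_predP[M fM] /bounded_predP[N gN].
apply/bounded_predP; exists (`|a| * M + N) => x.
rewrite (le_trans (ler_normD _ _))// lerD//.
by rewrite normrM ler_wpM2l.
Qed.

HB.instance Definition _ :=
  GRing.isSubmodClosed.Build _ _ bounded_pred bounded_pred_submod_closed.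

Record linf := Linf { linf_fun :> R -> R ; linf_bounded : linf_fun \in bounded_pred }.

HB.instance Definition _ := [isSub for linf_fun].
HB.instance Definition _ := [Choice of linf by <:].
HB.instance Definition _ := [SubChoice_isSubLmodule of linf by <:].

Definition linf_norm (f : linf) : R := sup [set `|f x| | x in [set: R]].

Lemma linf_has_sup (f : linf) : has_sup [set `|f x| | x in [set: R]].
Proof.
have /bounded_predP[M fM] := linf_bounded f.
split; first by exists `|f 0|, 0.
by exists M => _ [x _ <-].
Qed.

Lemma le_linf_norm (f : linf) (x : R) : `|f x| <= linf_norm f.
Proof. by apply: sup_ubound; [exact: (linf_has_sup f).2 | exists x]. Qed.

Lemma linf_norm_le (f : linf) (M : R) :
  (forall x, `|f x| <= M) -> linf_norm f <= M.
Proof.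
move=> fM; apply: ge_sup; first exact: (linf_has_sup f).1.
by move=> _ [x _ <-].
Qed.

Lemma linf_normD (f g : linf) : linf_norm (f + g) <= linf_norm f + linf_norm g.
Proof.
apply: linf_norm_le => x.
by rewrite (le_trans (ler_normD _ _))// lerD// le_linf_norm.
Qed.

Lemma linf_normZ (l : R) (f : linf) : linf_norm (l *: f) = `|l| * linf_norm f.
Proof.
have le_normZ (k : R) (g : linf) : linf_norm (k *: g) <= `|k| * linf_norm g.
  by apply: linf_norm_le => x; rewrite normrM ler_wpM2l// le_linf_norm.
apply/eqP; rewrite eq_le le_normZ /=.
have [->|l0] := eqVneq l 0.
  by rewrite normr0 mul0r (le_trans _ (le_linf_norm _ 0)).
rewrite -ler_pdivlMl ?normr_gt0// -normfV.
by have := le_normZ l^-1 (l *: f); rewrite scalerA mulVf// scale1r.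
Qed.

Lemma linf_norm0_eq0 (f : linf) : linf_norm f = 0 -> f = 0.
Proof.
move=> f0; apply/val_inj/funext => x /=; apply/eqP.
by rewrite -normr_le0 -f0 le_linf_norm.
Qed.

HB.instance Definition _ :=
  Lmodule_isNormed.Build R linf linf_normD linf_normZ linf_norm0_eq0.

Lemma linf_normE (f : linf) : `|f| = sup [set `|f x| | x in [set: R]].
Proof. by []. Qed.

Lemma linf_cst_subproof (c : R) : cst c \in bounded_pred.
Proof. by apply/bounded_predP; exists `|c|. Qed.

Definition linf_cst (c : R) : linf := Linf (linf_cst_subproof c).

End BoundedFunctions.

(** * Ergodic metric dynamical systems and random coefficients *)

Record ergodic_mds {d : measure_display} {T : measurableType d} {R : realType}
    (P : probability T R) (theta : R -> T -> T) : Prop := ErgodicMDS {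
  mds_id : forall w, theta 0 w = w ;
  mds_flow : forall s t w, theta (s + t) w = theta s (theta t w) ;
  mds_measurable :
    measurable_fun [set: measurableTypeR R * T] (fun p => theta p.1 p.2) ;
  mds_preserving : forall t (A : set T), measurable A ->
    P (theta t @^-1` A) = P A ;
  mds_ergodic : forall A : set T, measurable A ->
    (forall t, theta t @^-1` A = A) -> P A = 0%E \/ P A = 1%E }.

(* The exponent and the constant may depend on the point. *)
Definition locally_hoelder {R : realType} (f : R -> R) : Prop :=
  forall t0 : R, exists alpha C : R, 0 < alpha <= 1 /\
    \forall s & t \near t0, `|f t - f s| <= C * `|t - s| `^ alpha.

Section Means.
Context {R : realType}.

Definition time_mean (f : R -> R) (s t : R) : R :=
  (t - s)^-1 * (\int[lebesgue_measure]_(tau in `[s, t]) f tau)%R.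

(* Both limits are limits of monotone functions of r, hence exist in \bar R. *)
Definition lower_mean (f : R -> R) : \bar R :=
  lim ((fun r : R => ereal_inf
    [set (time_mean f p.1 p.2)%:E | p in [set p : R * R | r <= p.2 - p.1]])
    @ +oo).

Definition upper_mean (f : R -> R) : \bar R :=
  lim ((fun r : R => ereal_sup
    [set (time_mean f p.1 p.2)%:E | p in [set p : R * R | r <= p.2 - p.1]])
    @ +oo).

End Means.

(** * Solutions in l^oo of the lattice-type KPP equation *)

(* The derivative is taken in the sup norm: ['linf R'] is the codomain of [u].
   Only the restriction of [u] to [0, +oo[ matters. *)
Definition kpp_solution {R : realType} (c : R -> R) (u0 : linf R)
    (u : R -> linf R) : Prop :=
  [/\ u 0 = u0,
      {within `[0, +oo[, continuous u} &
      forall t : R, 0 < t -> derivable u t 1 /\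
        forall x : R, derive1 u t x =
          u t (x + 1) + u t (x - 1) - 2 * u t x + c t * u t x * (1 - u t x)].

(* Main.v *)
Require Import Defs.
From mathcomp Require Import all_boot all_order all_algebra.
From mathcomp Require Import all_classical all_reals all_analysis.
From mathcomp Require Import ring lra.
Import Order.TTheory GRing.Theory Num.Theory.
Import numFieldNormedType.Exports.
Local Open Scope classical_set_scope.
Local Open Scope ring_scope.

(** Freeze a sample point and write [c t] for [a (theta t w)]. It is a positive
function, continuous because it is locally Hoelder continuous. Write [Delta]
for the discrete Laplacian [v (x + 1) + v (x - 1) - 2 v x].

The right-hand side of the equation is cooperative in the neighbours
[u (x + 1)] and [u (x - 1)], so differential inequalities on a bounded time
segment propagate signs, uniformly in the uncountably many sites [x]
([lattice_max_principle]). This is used twice.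

- Constants [de] in [0, 1] are subsolutions, since [de (1 - de) >= 0]. Taking
  [de = min (inf u0) 1], which is positive, gives [u >= de] for all times
  ([kpp_ge_cst]).
- The difference [q = u - 1] solves the linear equation
  [q' = Delta q - c u q], whose damping rate [c u] is at least [de c]. Hence
  [q] and [-q] stay below the space-independent supersolution
  [|q 0| exp (- de A t)], where [A t] is the integral of [c] over [0, t]
  ([kpp_decay]).

A positive lower mean makes [A] grow at least linearly
([lower_mean_gt0_linear_growth]), and the sup norm of [q] tends to zero,
exponentially fast. On [Omega0] the lower mean is the positive constant
[a_low], so this applies at every sample point there. *)

(** * A maximum principle on the lattice *)

Lemma derive_ge0_ge_init {R : realType} {T : R} {f df : R -> R} :
  {within `[0, T], continuous f} ->
  (forall t, 0 < t < T -> is_derive t 1 f (df t)) ->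
  (forall t, 0 < t < T -> 0 <= df t) ->
  forall t, 0 <= t <= T -> f 0 <= f t.
Proof.
move=> fc fd df0 t /andP[t0 tT].
apply: (@ger0_derive1_le_cc _ f 0 T) => //.
- by move=> x; rewrite in_itv/= => /fd[].
- by move=> x; rewrite in_itv/= => /[dup]xT /fd[_]; rewrite derive1E => ->; exact: df0.
- by rewrite in_itv/= lexx (le_trans t0).
- by rewrite in_itv/= t0.
Qed.

(** With infinitely many sites a minimum over [x] need not be attained, so the
sign is obtained by iteration instead of at a first touching point: if
[w >= - g] with [g >= 0], the inequality gives [w' >= - (B + 2) g], and
integrating from [w 0 >= 0] improves the bound. Starting from the constant [M],
the [n]-th bound is the [n]-th term of an exponential series. *)
Lemma cooperative_lower_bound {R : realType} {T B M : R}
    {w dw b : R -> R -> R} :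
  0 <= M ->
  (forall x, {within `[0, T], continuous (w ^~ x)}) ->
  (forall t x : R, 0 < t < T -> is_derive t 1 (w ^~ x) (dw t x)) ->
  (forall t x : R, 0 < t < T ->
     w t (x + 1) + w t (x - 1) + b t x * w t x <= dw t x) ->
  (forall t x : R, 0 < t < T -> 0 <= b t x <= B) ->
  (forall t x : R, 0 <= t <= T -> - M <= w t x) ->
  (forall x, 0 <= w 0 x) ->
  forall n t x, 0 <= t <= T -> - (M * exp_coeff ((B + 2) * t) n) <= w t x.
Proof.
move=> M0 wc wd wge b0B wM w0; elim=> [|n IH] t x tT.
  by rewrite /exp_coeff/= expr0 fact0 divr1 mulr1; exact: wM.
(* The bound is a monomial in time; [k'E] says that its derivative is [B + 2]
times the preceding bound. *)
set k := M * (B + 2) ^+ n.+1 / n.+1`!%:R.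
have kE s : k * s ^+ n.+1 = M * exp_coeff ((B + 2) * s) n.+1.
  by rewrite /k /exp_coeff/= exprMn; ring.
have k'E s : k * (n.+1%:R * s ^+ n) = (B + 2) * (M * exp_coeff ((B + 2) * s) n).
  rewrite /k /exp_coeff/= exprMn factS natrM exprS.
  have H0 : n`!%:R != 0 :> R by rewrite pnatr_eq0 -lt0n fact_gt0.
  have H : n.+1%:R != 0 :> R by rewrite pnatr_eq0.
  move: n.+1%:R n`!%:R H H0 => p q p0 q0.
  by field; rewrite p0 q0.
have H : 0 <= w 0 x + k * 0 ^+ n.+1 by rewrite expr0n/= mulr0 addr0.
rewrite -kE -subr_ge0 opprK.
apply: (le_trans H).
apply: (@derive_ge0_ge_init _ T (fun s => w s x + k * s ^+ n.+1)
  (fun s => dw s x + k * (n.+1%:R * s ^+ n))) => //.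
- move=> s; apply: cvgD; first exact: wc.
  apply: cvgM; first exact: cvg_cst.
  have xnc : {within `[0, T], continuous (fun r : R => r ^+ n.+1)}.
    by apply: continuous_subspaceT; exact: exprn_continuous.
  exact: xnc.
- move=> s sT; have := wd s x sT => ?; apply: is_deriveD.
  have xd : is_derive s 1 (fun r : R => r ^+ n.+1) (n.+1%:R * s ^+ n).
    by apply: DeriveDef; [exact: exprn_derivable | rewrite -derive1E exp_derive1].
  exact: (@is_deriveZ _ _ _ (fun r : R => r ^+ n.+1) k s 1 _ xd).
- move=> s sT.
  have sT' : 0 <= s <= T by case/andP: sT => /ltW -> /ltW ->.
  rewrite k'E.
  have := wge s x sT; have /andP[b1 b2] := b0B s x sT.
  have := IH s (x + 1) sT'; have := IH s (x - 1) sT'; have := IH s x sT'.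
  set g := M * _.
  have g0 : 0 <= g.
    rewrite /g /exp_coeff/= mulr_ge0// divr_ge0// exprn_ge0// mulr_ge0//.
      lra.
    by case/andP: sT'.
  move=> h1 h2 h3 h4; nra.
Qed.

(** The terms of the exponential series tend to zero, so the lower bounds above
converge to zero at every time and site. *)
Lemma cooperative_ge0 {R : realType} {T B M : R}
    {w dw b : R -> R -> R} :
  (forall x, {within `[0, T], continuous (w ^~ x)}) ->
  (forall t x : R, 0 < t < T -> is_derive t 1 (w ^~ x) (dw t x)) ->
  (forall t x : R, 0 < t < T ->
     w t (x + 1) + w t (x - 1) + b t x * w t x <= dw t x) ->
  (forall t x : R, 0 < t < T -> 0 <= b t x <= B) ->
  (forall t x : R, 0 <= t <= T -> - M <= w t x) ->
  (forall x, 0 <= w 0 x) ->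
  forall t x : R, 0 <= t <= T -> 0 <= w t x.
Proof.
move=> wc wd wge b0B wM w0 t x tT.
have wM' s y : 0 <= s <= T -> - `|M| <= w s y.
  by move=> /(wM s y); apply: le_trans; rewrite lerN2 ler_norm.
have := cooperative_lower_bound (normr_ge0 M) wc wd wge b0B wM' w0.
move=> /(_ _ t x tT) bound.
have lim0 : - (`|M| * exp_coeff ((B + 2) * t) n) @[n --> \oo] --> (0 : R).
  rewrite -oppr0 -(mulr0 `|M|); apply: cvgN; apply: cvgMr.
  exact: cvg_exp_coeff.
by apply: (cvgr_to_le lim0); exact: nearW.
Qed.

(** The coefficient [b] contains the diagonal part of the discrete Laplacian, so
it can be negative in applications. A bounded [b] becomes nonnegative after
multiplying [w] by [exp (B t)], which adds [B] to [b]. *)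
Lemma lattice_max_principle {R : realType} {T B M : R}
    {w dw b : R -> R -> R} :
  (forall x, {within `[0, T], continuous (w ^~ x)}) ->
  (forall t x : R, 0 < t < T -> is_derive t 1 (w ^~ x) (dw t x)) ->
  (forall t x : R, 0 < t < T ->
     w t (x + 1) + w t (x - 1) + b t x * w t x <= dw t x) ->
  (forall t x : R, 0 < t < T -> `|b t x| <= B) ->
  (forall t x : R, 0 <= t <= T -> `|w t x| <= M) ->
  (forall x, 0 <= w 0 x) ->
  forall t x : R, 0 <= t <= T -> 0 <= w t x.
Proof.
move=> wc wd wge bB wM w0 t x tT.
rewrite -(pmulr_rge0 _ (expR_gt0 (B * t))).
pose W s y := expR (B * s) * w s y.
apply: (@cooperative_ge0 _ T (2 * B) (expR (`|B| * T) * M) W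
  (fun s y => expR (B * s) * (dw s y + B * w s y))
  (fun s y => B + b s y) _ _ _ _ _ _ t x tT).
- move=> y s; apply: cvgM; last exact: wc.
  have ec : {within `[0, T], continuous (fun r : R => expR (B * r))}.
    apply: continuous_subspaceT => r; apply: continuous_comp.
      exact: mulrl_continuous.
    exact: continuous_expR.
  exact: ec.
- move=> s y sT; have := wd s y sT => wdd.
  have Bd : is_derive s 1 (fun r : R => B * r) (B *: 1) by exact: is_deriveZ.
  have eBd := is_derive1_comp (is_derive_expR _) Bd.
  apply: (is_derive_eq (is_deriveM eBd wdd)).
  by rewrite /GRing.scale/=; ring.
- move=> s y sT; have := wge s y sT.
  rewrite -subr_ge0 => wge'; rewrite -subr_ge0.
  have -> : expR (B * s) * (dw s y + B * w s y) -
     (W s (y + 1) + W s (y - 1) + (B + b s y) * W s y) =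
     expR (B * s) * (dw s y - (w s (y + 1) + w s (y - 1) + b s y * w s y)).
    by rewrite /W; ring.
  by rewrite mulr_ge0// expR_ge0.
- move=> s y sT; have := bB s y sT; rewrite ler_norml => /andP[? ?].
  by apply/andP; split; lra.
- move=> s y sT; rewrite /W.
  have : `|expR (B * s) * w s y| <= expR (`|B| * T) * M.
    rewrite normrM ler_pM// ?wM// ger0_norm ?expR_ge0// ler_expR.
    case/andP: sT => s0 sT.
    by rewrite (le_trans (ler_norm _))// normrM (ger0_norm s0) ler_wpM2l.
  by rewrite ler_norml => /andP[].
- by move=> y; rewrite /W mulr_ge0// expR_ge0.
Qed.

(** * Continuity, evaluation of bounded functions, time averages *)

Section Tools.
Set Implicit Arguments.
Unset Strict Implicit.
Context {R : realType}.
Implicit Types (f c : R -> R) (u : R -> linf R).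

Notation primitive c t := (parameterized_integral lebesgue_measure 0 t c).

Lemma locally_hoelder_continuous f : locally_hoelder f -> continuous f.
Proof.
move=> fh t0; have [al [C [/andP[al0 al1] fC]]] := fh t0.
apply/cvgrPdist_le => e e0.
have C1 : 0 < `|C| + 1 by rewrite ltr_wpDl.
(* [C] may be zero or negative, hence the constant [`|C| + 1] instead. *)
pose r := (e / (`|C| + 1)) `^ al^-1.
have r0 : 0 < r by rewrite powR_gt0// divr_gt0.
case: fC => -[/= P Q] [Pt0 Qt0] PQ.
near=> t.
have : `|f t - f t0| <= C * `|t - t0| `^ al.
  apply: (PQ (t0, t)); split => /=; last by near: t.
  exact: nbhs_singleton.
rewrite distrC => /le_trans; apply.
have tr : `|t - t0| <= r.
  by rewrite distrC; near: t; exact: (@cvgr_dist_le _ _ _ _ _ id).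
have pr : `|t - t0| `^ al <= e / (`|C| + 1).
  have -> : e / (`|C| + 1) = r `^ al.
    by rewrite /r -powRrM mulVf ?gt_eqF// powRr1// ltW// divr_gt0.
  by apply: ge0_ler_powR; rewrite ?nnegrE//; exact: ltW.
apply: (@le_trans _ _ ((`|C| + 1) * (e / (`|C| + 1)))); last first.
  by rewrite mulrC divfK ?gt_eqF.
apply: (@le_trans _ _ ((`|C| + 1) * `|t - t0| `^ al)).
  by rewrite ler_wpM2r ?powR_ge0// (le_trans (ler_norm _))// lerDl.
by rewrite ler_wpM2l// ltW.
Unshelve. all: by end_near.
Qed.

Lemma linf_eval_continuous (x : R) : continuous (fun f : linf R => f x).
Proof.
move=> f; apply/(@cvgrPdist_le _ _ _ (nbhs f) (nbhs_filter f)) => e e0.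
have /(_ _ e0) := @cvgr_dist_le _ _ _ (nbhs f) (nbhs_filter f) id f cvg_id.
apply: (@filterS _ (nbhs f) (nbhs_filter f)) => g.
exact: le_trans (le_linf_norm (f - g) x).
Qed.

(** Evaluation at a site is linear and 1-Lipschitz for the sup norm, so it
commutes with the derivative taken in that norm. *)
Lemma linf_eval_is_derive u (t x : R) : derivable u t 1 ->
  is_derive t 1 (fun s => u s x) (derive1 u t x).
Proof.
rewrite derive1E => ud.
have evd := cvg_comp _ _ ud (@linf_eval_continuous x ('D_1 u t)).
apply: DeriveDef; first by apply/cvg_ex; exists ('D_1 u t x); exact: evd.
by apply: cvg_lim; [exact: Rhausdorff | exact: evd].
Qed.

Lemma linf_bounded_segment u (T : R) : 0 <= T ->
  {within `[0, T], continuous u} ->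
  exists M : R, forall t x : R, 0 <= t <= T -> `|u t x| <= M.
Proof.
move=> T0 uc.
have nc : {within `[0, T], continuous (fun t => `|u t|)}.
  move=> t; apply: (@cvg_comp _ _ _ u (fun f : linf R => `|f|)); first exact: uc.
  exact: norm_continuous.
have [s _ us] := EVT_max T0 nc.
exists `|u s| => t x tT; apply: le_trans (le_linf_norm (u t) x) _.
exact: us.
Qed.

Lemma primitive_derive c (t : R) : continuous c -> 0 < t ->
  is_derive t 1 (fun s => primitive c s) (c t).
Proof.
move=> cc t0.
have ci : lebesgue_measure.-integrable `[0, t + 1] (EFin \o c).
  apply: continuous_compact_integrable; first exact: segment_compact.
  exact: continuous_subspaceT.
have t1 : t < t + 1 by rewrite ltrDl.
have [dA A'] := continuous_FTC1_closed t1 ci t0 (cc t).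
by apply: DeriveDef => //; rewrite -derive1E.
Qed.

Lemma primitive_continuous c (T : R) : continuous c -> 0 <= T ->
  {within `[0, T], continuous (fun s => primitive c s)}.
Proof.
move=> cc T0; apply: parameterized_integral_continuous => //.
apply: continuous_compact_integrable; first exact: segment_compact.
exact: continuous_subspaceT.
Qed.

(** The infimum in the definition of the lower mean is monotone in [r], so its
limit is a supremum and a single [r] already has a positive infimum; it is then
applied to the windows that start at time 0. *)
Lemma lower_mean_gt0_linear_growth c : (0 < lower_mean c)%E ->
  exists k r : R, 0 < k /\ forall t, r <= t -> k * t <= primitive c t.
Proof.
rewrite /lower_mean; set g := (fun r : R => _).
have gmono : {homo g : n m / (n <= m)%R >-> (n <= m)%E}.
  move=> n m nm; apply: le_ereal_inf => _ [p /= mp <-]; exists p => //=.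
  exact: le_trans nm mp.
rewrite (cvg_lim _ (nondecreasing_cvge gmono))//.
move=> /ereal_sup_gt[_ [r _ <-] gr].
have [k k0 kg] : exists2 k : R, 0 < k & (k%:E <= g r)%E.
  case: (g r) gr => [k k0| _|//]; first by exists k.
  by exists 1 => //; rewrite leey.
exists k, (Num.max r 1); split => // t; rewrite ge_max => /andP[rt t1].
have t0 : 0 < t by exact: lt_le_trans t1.
have : (g r <= (time_mean c 0 t)%:E)%E.
  by apply: ereal_inf_lbound; exists (0, t) => //=; rewrite subr0.
move=> /(le_trans kg); rewrite lee_fin /time_mean subr0.
by rewrite ler_pdivlMl// mulrC.
Qed.

Lemma primitive_at0 c : primitive c 0 = 0.
Proof. by rewrite /parameterized_integral set_itv1 Rintegral_set1. Qed.

Lemma continuous_ubounded_segment c (T : R) : continuous c -> 0 <= T ->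
  exists M : R, forall t, 0 <= t <= T -> c t <= M.
Proof.
move=> cc T0.
have [s _ cs] := EVT_max T0 (continuous_subspaceT cc).
by exists (c s) => t tT; exact: cs.
Qed.

End Tools.

(** * The KPP equation with a positive continuous coefficient *)

Section Kpp.
Set Implicit Arguments.
Unset Strict Implicit.
Context {R : realType}.
Implicit Types (c : R -> R) (u : R -> linf R).

Notation primitive c t := (parameterized_integral lebesgue_measure 0 t c).

Lemma kpp_is_derive c (u0 : linf R) u (t x : R) : kpp_solution c u0 u -> 0 < t ->
  is_derive t 1 (fun s => u s x)
   (u t (x + 1) + u t (x - 1) - 2 * u t x + c t * u t x * (1 - u t x)).
Proof. by case=> _ _ /(_ t) ud /ud[ut <-]; exact: linf_eval_is_derive. Qed.

Lemma kpp_eval_continuous c (u0 : linf R) u (T x : R) : kpp_solution c u0 u ->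
  {within `[0, T], continuous (fun s => u s x)}.
Proof.
case=> _ uc _.
have uT : {within `[0, T], continuous u}.
  apply: continuous_subspaceW uc => t /=; rewrite !in_itv/= andbT.
  by case/andP.
move=> t; apply: (@cvg_comp _ _ _ u (fun f : linf R => f x)); first exact: uT.
exact: linf_eval_continuous.
Qed.

Lemma kpp_bounded_segment c (u0 : linf R) u (T : R) : kpp_solution c u0 u -> 0 <= T ->
  exists M : R, forall t x : R, 0 <= t <= T -> `|u t x| <= M.
Proof.
case=> _ uc _ T0; apply: linf_bounded_segment => //.
apply: continuous_subspaceW uc => t /=; rewrite !in_itv/= andbT.
by case/andP.
Qed.

(** Comparison with the stationary subsolution [de]: for [w = u - de] the
reaction term is [c u (1 - u) = c (1 - de - u) w + c de (1 - de)], whose last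
summand is nonnegative. *)
Lemma kpp_ge_cst c (u0 : linf R) u (de : R) : continuous c -> (forall t, 0 < c t) ->
  kpp_solution c u0 u -> 0 <= de <= 1 -> (forall x, de <= u0 x) ->
  forall t x : R, 0 <= t -> de <= u t x.
Proof.
move=> cc c0 us /andP[de0 de1] u0de t x t0.
have [M uM] := kpp_bounded_segment us t0.
have [N cN] := continuous_ubounded_segment cc t0.
rewrite -subr_ge0.
apply: (@lattice_max_principle _ t (N * (1 + M) + 2) (M + 1)
  (fun s y => u s y - de)
  (fun s y => u s (y + 1) + u s (y - 1) - 2 * u s y + c s * u s y * (1 - u s y))
  (fun s y => c s * (1 - de - u s y) - 2)); last by rewrite t0 lexx.
- move=> y s; apply: cvgB; last exact: cvg_cst.
  exact: (kpp_eval_continuous us).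
- move=> s y /andP[s0 _].
  have := kpp_is_derive y us s0 => usd.
  apply: (is_derive_eq (is_deriveB usd (is_derive_cst (de : R) s 1))).
  by rewrite subr0.
- move=> s y _; rewrite -subr_ge0.
  have -> : forall p q r C, p + q - 2 * r + C * r * (1 - r) -
     (p - de + (q - de) + (C * (1 - de - r) - 2) * (r - de)) = C * (de * (1 - de)).
    by move=> p q r C; ring.
  by rewrite mulr_ge0 ?mulr_ge0 ?subr_ge0// ltW.
- move=> s y /andP[s0 st].
  have sT : 0 <= s <= t by rewrite !ltW.
  rewrite (le_trans (ler_normB _ _))// lerD//; last by rewrite ger0_norm.
  have cs0 : 0 <= c s by rewrite ltW.
  rewrite normrM (ger0_norm cs0) ler_pM// ?cN//.
  rewrite (le_trans (ler_normB _ _))// lerD// ?uM// ger0_norm; lra.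
- move=> s y sT.
  rewrite (le_trans (ler_normB _ _))// lerD// ?uM// ger0_norm; lra.
- by move=> y; case: us => -> _ _; rewrite subr_ge0.
Qed.

(** The right-hand side [E t] of the estimate is constant in space and satisfies
[E' = - de c E]. Therefore both [w = E - (u - 1)] and [w = E + (u - 1)] satisfy
[w' = Delta w - c u w + c (u - de) E], where the last term is nonnegative. *)
Lemma kpp_decay c (u0 : linf R) u (de : R) : continuous c -> (forall t, 0 < c t) ->
  kpp_solution c u0 u -> 0 <= de ->
  (forall t x : R, 0 <= t -> de <= u t x) ->
  forall t x : R, 0 <= t ->
  `|u t x - 1| <= `|u0 - linf_cst 1| * expR (- (de * primitive c t)).
Proof.
move=> cc c0 us de0 ude t x t0.
pose A s := primitive c s.
pose N := `|u0 - linf_cst 1|.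
pose E s := N * expR (- (de * A s)).
have N0 : 0 <= N by exact: normr_ge0.
have E0 (s : R) : 0 <= E s by rewrite mulr_ge0 ?expR_ge0.
have EN (s : R) : 0 <= s -> E s <= N.
  move=> s0; rewrite ler_piMr// -[leRHS]expR0 ler_expR oppr_le0 mulr_ge0//.
  by apply: Rintegral_ge0 => // r _; exact: ltW.
have Ec : {within `[0, t], continuous E}.
  move=> s; apply: cvgM; first exact: cvg_cst.
  apply: (@cvg_comp _ _ _ (fun s => - (de * A s)) expR); last exact: continuous_expR.
  apply: cvgN; apply: cvgM; first exact: cvg_cst.
  exact: primitive_continuous.
have Ed (s : R) : 0 < s -> is_derive s 1 E (- (de * c s) * E s).
  move=> s0; have Ad := primitive_derive cc s0.
  have dAd : is_derive s 1 (fun r : R => - (de * A r)) (- (de * c s)).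
    by apply: (is_derive_eq (is_deriveN (is_deriveZ de Ad))).
  have eAd := is_derive1_comp (is_derive_expR _) dAd.
  apply: (is_derive_eq (is_deriveZ N eAd)).
  by rewrite /E /GRing.scale/=; ring.
have [M uM] := kpp_bounded_segment us t0.
have [K cK] := continuous_ubounded_segment cc t0.
have u1M (s y : R) : 0 <= s <= t -> `|u s y - 1| <= M + 1.
  move=> sT; rewrite (le_trans (ler_normB _ _))// lerD// ?uM//.
  by rewrite normr1.
(* The sign [sg] treats the two one-sided bounds at once. *)
have key (sg : R) : `|sg| = 1 -> 0 <= E t - sg * (u t x - 1).
  move=> sg1.
  apply: (@lattice_max_principle _ t (2 + K * M) (N + (M + 1))
   (fun s y => E s - sg * (u s y - 1))
   (fun s y => - (de * c s) * E s - sg *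
     (u s (y + 1) + u s (y - 1) - 2 * u s y + c s * u s y * (1 - u s y)))
   (fun s y => - 2 - c s * u s y)); last by rewrite t0 lexx.
  - move=> y s; apply: cvgB; first exact: Ec.
    apply: cvgM; first exact: cvg_cst.
    apply: cvgB; last exact: cvg_cst.
    exact: (kpp_eval_continuous us).
  - move=> s y /andP[s0 _].
    have usd := kpp_is_derive y us s0.
    have u1d := is_deriveB usd (is_derive_cst (1 : R) s 1).
    apply: (is_derive_eq (is_deriveB (Ed s s0) (is_deriveZ sg u1d))).
    by rewrite subr0.
  - move=> s y /andP[s0 _]; rewrite -subr_ge0.
    have := ude s y (ltW s0); have := c0 s; have := E0 s.
    move: (E s) (c s) (u s y) (u s (y + 1)) (u s (y - 1)) => e C q p r e0 C0 dq.
    have -> : - (de * C) * e - sg * (p + r - 2 * q + C * q * (1 - q)) -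
     (e - sg * (p - 1) + (e - sg * (r - 1)) +
      (- 2 - C * q) * (e - sg * (q - 1))) = C * (q - de) * e by ring.
    by rewrite mulr_ge0// mulr_ge0 ?subr_ge0// ltW.
  - move=> s y /andP[s0 st].
    have sT : 0 <= s <= t by rewrite !ltW.
    rewrite (le_trans (ler_normB _ _))// lerD//; first by rewrite normrN ger0_norm.
    have cs0 : 0 <= c s by rewrite ltW.
    by rewrite normrM (ger0_norm cs0) ler_pM// ?cK// ?uM.
  - move=> s y sT.
    rewrite (le_trans (ler_normB _ _))// lerD//.
      by rewrite ger0_norm ?EN//; case/andP: sT.
    by rewrite normrM sg1 mul1r u1M.
  - move=> y; rewrite /E /A primitive_at0 mulr0 oppr0 expR0 mulr1 subr_ge0.
    rewrite (le_trans (ler_norm _))// normrM sg1 mul1r.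
    case: us => -> _ _; exact: (le_linf_norm (u0 - linf_cst 1) y).
have := key 1 (normr1 _); have := key (-1) (normrN1 _).
rewrite -/(A t) -/N -/(E t) ler_norml mul1r mulN1r => h1 h2.
by apply/andP; split; lra.
Qed.

Theorem kpp_convergence c (u0 : linf R) u : continuous c -> (forall t, 0 < c t) ->
  (0 < lower_mean c)%E -> 0 < inf [set u0 x | x in [set: R]] ->
  kpp_solution c u0 u -> `|u t - linf_cst 1| @[t --> +oo] --> (0 : R).
Proof.
move=> cc c0 mc i0 us.
set i := inf _ in i0.
have u0i x : i <= u0 x.
  apply: ge_inf; last by exists x.
  have /bounded_predP[M uM] := linf_bounded u0.
  exists (- M) => _ [y _ <-].
  by have := uM y; rewrite ler_norml => /andP[].
pose de := Num.min i 1.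
have de0 : 0 < de by rewrite lt_min i0 ltr01.
have de1 : de <= 1 by rewrite ge_min lexx orbT.
have ude : forall t x : R, 0 <= t -> de <= u t x.
  apply: (kpp_ge_cst cc c0 us); first by rewrite ltW.
  by move=> x; rewrite (le_trans _ (u0i x))// ge_min lexx.
have [k [r [k0 kr]]] := lower_mean_gt0_linear_growth mc.
have dec := kpp_decay cc c0 us (ltW de0) ude.
apply: (@squeeze_cvgr _ _ _ _ (cst 0)
  (fun t => `|u0 - linf_cst 1| * expR (- (de * k * t)))).
- near=> t.
  have t0 : 0 <= t by near: t; apply: nbhs_pinfty_ge; exact: num_real.
  have rt : r <= t by near: t; apply: nbhs_pinfty_ge; exact: num_real.
  rewrite normr_ge0/=; apply: linf_norm_le => x.
  apply: (le_trans (dec t x t0)); rewrite ler_wpM2l// ler_expR lerN2.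
  by rewrite -mulrA ler_wpM2l ?(ltW de0)// kr.
- exact: cvg_cst.
- rewrite -(mulr0 `|u0 - linf_cst 1|); apply: cvgMr.
  apply: (@cvg_comp _ _ _ (fun t => de * k * t) (fun t => expR (- t))); last exact: cvgr_expR.
  by apply: gt0_cvgMry; [exact: mulr_gt0|exact: cvg_id].
Unshelve. all: by end_near.
Qed.

End Kpp.

Theorem proposition2p2 (R : realType) (d : measure_display)
  (T : measurableType d) (P : probability T R)
  (theta : R -> T -> T) (theta_mds : ergodic_mds P theta)
  (a : T -> R) (a_gt0 : forall w, 0 < a w) (a_meas : measurable_fun [set: T] a)
  (a_hoelder : forall w, locally_hoelder (fun t => a (theta t w)))
  (a_means : {ae P, forall w,
    [/\ (0 < lower_mean (fun t => a (theta t w)))%E,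
        (lower_mean (fun t => a (theta t w)) <=
           upper_mean (fun t => a (theta t w)))%E &
        (upper_mean (fun t => a (theta t w)) < +oo)%E]})
  (a_low a_upp : R) (a_low_gt0 : 0 < a_low) (a_upp_gt0 : 0 < a_upp)
  (Omega0 : set T) (Omega0_meas : measurable Omega0) (Omega0_full : P Omega0 = 1%E)
  (Omega0_inv : forall t, theta t @` Omega0 = Omega0)
  (Omega0_low : forall w, Omega0 w ->
    lower_mean (fun t => a (theta t w)) = a_low%:E)
  (Omega0_upp : forall w, Omega0 w ->
    upper_mean (fun t => a (theta t w)) = a_upp%:E) :
  forall u0 : linf R, 0 < inf [set u0 x | x in [set: R]] ->
  forall w : T, Omega0 w ->
  forall u : R -> linf R, kpp_solution (fun t => a (theta t w)) u0 u ->
  `|u t - linf_cst 1| @[t --> +oo] --> (0 : R).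
Proof.
move=> u0 u0_gt0 w Ow u; apply: kpp_convergence => //.
- exact: locally_hoelder_continuous.
- by rewrite Omega0_low.
Qed.
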